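(* Let $\underline{C}$ be a triangulated category endowed with a weight structure $w$, let $m\le n$ be integers, and let $M\in\operatorname{Obj}\underline{C}$. I. The following conditions are equivalent. (I.1) $M$ is without weights $m,\dots,n$. (I.2) $M$ is a retract of some $\widetilde M\in\operatorname{Obj}\underline{C}$ that is an extension of an element of $\underline{C}_{w\ge n+1}$ by an element of $\underline{C}_{w\le m-1}$. (I.3) $H(M)=0$ for every cohomological functor $H$ (from $\underline{C}$ into an abelian category) of weight range $[m,n]$. (I.4) $H(M)=\{0\}$ for $H=\tau_{\le n}(H_I)$ whenever $I\in\underline{C}_{w\ge m}$. (I.5) $H(M)=\{0\}$, where $H=\tau_{\le n}(H_{I_0})$ and $I_0$ is a fixed choice of $w_{\ge m}M$. II. Moreover, if $\underline{C}$ is idempotent complete (that is, all idempotent endomorphisms split in it), then the conditions above are also equivalent to the following ones. (II.1) $M$ itself is an extension of an element of $\underline{C}_{w\ge n+1}$ by an element of $\underline{C}_{w\le m-1}$. (II.2) There exist isomorphic choices of the weight truncations $w_{\le m-1}M$ and $w_{\le n}M$. (II.3) There exists a choice of $w_{\le m-1}M$ and $w_{\le n}M$ such that the corresponding connecting morphism $w_{\le m-1}M\to w_{\le n}M$ is an isomorphism.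
   Context: Notation: $\underline{C}(X,Y)$ is the set of morphisms from $X$ to $Y$; for $I\in\operatorname{Obj}\underline{C}$, $H_I=\underline{C}(-,I)$. $X$ is a retract of $Y$ if $\operatorname{id}_X$ factors through $Y$. An object $C$ is an extension of $B$ by $A$ if there is a distinguished triangle $A\to C\to B\to A[1]$. For classes $D,E$ of objects, $D^{\perp}=\{Y:\underline{C}(X,Y)=0\ \forall X\in D\}$ and ${}^{\perp}E=\{X:\underline{C}(X,Y)=0\ \forall Y\in E\}$. Torsion theory: a couple $s=(\mathcal{LO},\mathcal{RO})$ of classes of objects of $\underline{C}$ with $\mathcal{LO}^{\perp}=\mathcal{RO}$, $\mathcal{LO}={}^{\perp}\mathcal{RO}$, and such that every object $M$ fits in a distinguished triangle $L_sM\to M\to R_sM\to L_sM[1]$ with $L_sM\in\mathcal{LO}$, $R_sM\in\mathcal{RO}$. Weight structure: if $\mathcal{LO}\subset\mathcal{LO}[1]$ for a torsion theory $(\mathcal{LO},\mathcal{RO})$, the couple $w=(\underline{C}_{w\le 0},\underline{C}_{w\ge 0})=(\mathcal{LO},\mathcal{RO}[-1])$ is called a weight structure. Set $\underline{C}_{w\le k}=\underline{C}_{w\le 0}[k]$ and $\underline{C}_{w\ge k}=\underline{C}_{w\ge 0}[k]$ for $k\in\mathbb{Z}$. Weight decompositions: for $k\in\mathbb{Z}$, a $k$-weight decomposition of $X$ is a distinguished triangle $w_{\le k}X\to X\to w_{\ge k+1}X\to (w_{\le k}X)[1]$ with $w_{\le k}X\in\underline{C}_{w\le k}$ and $w_{\ge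 k+1}X\in\underline{C}_{w\ge k+1}$. It always exists but is not canonical; ''a choice of $w_{\le k}X$ or $w_{\ge k+1}X$'' always comes from some such triangle, together with its connecting morphisms. Any $g\in \underline{C}(X,Y)$ extends to a morphism from a given $k$-weight decomposition of $X$ to a given $l$-weight decomposition of $Y$ whenever $k\le l$; the extension is unique if $k<l$. For $k<l$ the connecting morphism $w_{\le k}X\to w_{\le l}X$ is the one obtained in this way from $\operatorname{id}_X$. Killing weights: $g\in\underline{C}(M,N)$ kills weights $m,\dots,n$ if for some (equivalently, for any) choice of $w_{\le n}M$ and $w_{\ge m}N$ the composition $w_{\le n}M\to M\stackrel{g}{\to}N\to w_{\ge m}N$ is zero. An object $M$ is without weights $m,\dots,n$ if $\operatorname{id}_M$ kills weights $m,\dots,n$. Virtual $t$-truncation: for a contravariant functor $H$ from $\underline{C}$ into an abelian category, $\tau_{\le k}(H)(X)=\operatorname{Im}(H(w_{\le k+1}X)\to H(w_{\le k}X))$, defined via the connecting morphism $w_{\le k}X\to w_{\le k+1}X$; this essentially does not depend on choices and is a contravariant functor in $X$. A contravariant functor into an abelian category is cohomological if it converts distinguished triangles into long exact sequences. A cohomological functor $H$ is of weight range $[m,n]$ if it annihilates both $\underline{C}_{w\le m-1}$ and $\underline{C}_{w\ge n+1}$. *)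

(* Defs.v *)
From HB Require Import structures.
From mathcomp Require Import all_boot all_order all_algebra.
From mathcomp Require Import boolp.

Set Implicit Arguments.
Unset Strict Implicit.
Unset Printing Implicit Defensive.

Import GRing.Theory.
Local Open Scope ring_scope.

(* A [zmodType] carries a choice structure; given the classical axioms of      *)
(* [boolp] every abelian group has one, so taking the groups of morphisms in   *)
(* [zmodType] loses no generality.                                             *)

Declare Scope cat_scope.
Delimit Scope cat_scope with cat.
Local Open Scope cat_scope.

Record preadditive := Preadditive {
  obj :> Type;
  mor : obj -> obj -> zmodType;
  idm : forall X, mor X X;
  cmp : forall X Y Z, mor Y Z -> mor X Y -> mor X Z;
  cmp1m : forall X Y (f : mor X Y), cmp (idm Y) f = f;
  cmpm1 : forall X Y (f : mor X Y), cmp f (idm X) = f;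
  cmpA : forall X Y Z T (h : mor Z T) (g : mor Y Z) (f : mor X Y),
    cmp h (cmp g f) = cmp (cmp h g) f;
  cmpDl : forall X Y Z (g g' : mor Y Z) (f : mor X Y),
    cmp (g + g') f = cmp g f + cmp g' f;
  cmpDr : forall X Y Z (g : mor Y Z) (f f' : mor X Y),
    cmp g (f + f') = cmp g f + cmp g f'
}.

Arguments mor {_} X Y.
Arguments idm {_} X.
Arguments cmp {_ X Y Z} g f.

Notation "g \oc f" := (cmp g f) (at level 40, left associativity) : cat_scope.

Section Preadditive.
Variable C : preadditive.
Implicit Types X Y Z : C.

Definition is_iso X Y (f : mor X Y) : Prop :=
  exists g : mor Y X, g \oc f = idm X /\ f \oc g = idm Y.

Definition isomorphic X Y : Prop := exists f : mor X Y, is_iso f.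

(* Both initial and terminal. *)
Definition is_zero X : Prop :=
  forall Y, (forall f : mor X Y, f = 0) /\ (forall f : mor Y X, f = 0).

Definition is_biproduct X Y S (i1 : mor X S) (i2 : mor Y S)
    (p1 : mor S X) (p2 : mor S Y) : Prop :=
  [/\ p1 \oc i1 = idm X, p2 \oc i2 = idm Y, p1 \oc i2 = 0, p2 \oc i1 = 0
    & i1 \oc p1 + i2 \oc p2 = idm S].

Definition is_mono X Y (f : mor X Y) : Prop :=
  forall Z (u v : mor Z X), f \oc u = f \oc v -> u = v.

Definition is_epi X Y (f : mor X Y) : Prop :=
  forall Z (u v : mor Y Z), u \oc f = v \oc f -> u = v.

Definition is_kernel X Y K (f : mor X Y) (k : mor K X) : Prop :=
  f \oc k = 0 /\
  forall Z (u : mor Z X), f \oc u = 0 -> exists! v : mor Z K, k \oc v = u.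

Definition is_cokernel X Y Q (f : mor X Y) (q : mor Y Q) : Prop :=
  q \oc f = 0 /\
  forall Z (u : mor Y Z), u \oc f = 0 -> exists! v : mor Q Z, v \oc q = u.

(* The image as the kernel of the cokernel; meant for abelian categories. *)
Definition is_image X Y I (f : mor X Y) (i : mor I Y) : Prop :=
  exists Q (q : mor Y Q), is_cokernel f q /\ is_kernel q i.

(* Im f = Ker g as subobjects of Y. *)
Definition exact X Y Z (f : mor X Y) (g : mor Y Z) : Prop :=
  exists I (i : mor I Y), is_image f i /\ is_kernel g i.

Definition retract X Y : Prop :=
  exists (i : mor X Y) (p : mor Y X), p \oc i = idm X.

Definition idempotent_complete : Prop :=
  forall X (e : mor X X), e \oc e = e ->
    exists Y (i : mor Y X) (p : mor X Y), p \oc i = idm Y /\ i \oc p = e.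

End Preadditive.

Record additive_cat := AdditiveCat {
  additive_pre :> preadditive;
  additive_zero : exists Z : additive_pre, is_zero Z;
  additive_biproduct : forall X Y : additive_pre,
    exists S (i1 : mor X S) (i2 : mor Y S) p1 p2, is_biproduct i1 i2 p1 p2
}.

Record abelian_cat := AbelianCat {
  abelian_add :> additive_cat;
  abelian_kernel : forall (X Y : abelian_add) (f : mor X Y),
    exists K (k : mor K X), is_kernel f k;
  abelian_cokernel : forall (X Y : abelian_add) (f : mor X Y),
    exists Q (q : mor Y Q), is_cokernel f q;
  abelian_mono : forall (X Y : abelian_add) (f : mor X Y), is_mono f ->
    exists Z (g : mor Y Z), is_kernel g f;
  abelian_epi : forall (X Y : abelian_add) (f : mor X Y), is_epi f ->
    exists Z (g : mor Z X), is_cokernel g f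
}.

Record functor (C D : preadditive) := Functor {
  fob :> C -> D;
  fmor : forall X Y : C, mor X Y -> mor (fob X) (fob Y);
  fmor1 : forall X, fmor (idm X) = idm (fob X);
  fmorM : forall X Y Z (g : mor Y Z) (f : mor X Y),
    fmor (g \oc f) = fmor g \oc fmor f
}.

Record cofunctor (C D : preadditive) := Cofunctor {
  cofob :> C -> D;
  comor : forall X Y : C, mor X Y -> mor (cofob Y) (cofob X);
  comor1 : forall X, comor (idm X) = idm (cofob X);
  comorM : forall X Y Z (g : mor Y Z) (f : mor X Y),
    comor (g \oc f) = comor f \oc comor g
}.

Arguments fmor {C D} F {X Y} f : rename.
Arguments comor {C D} H {X Y} f : rename.

Definition fid (C : preadditive) : functor C C :=
  @Functor C C id (fun X Y f => f) (fun X => erefl) (fun X Y Z g f => erefl).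

Section FunctorComp.
Variables (C D E : preadditive) (G : functor D E) (F : functor C D).

Let fcomp_mor (X Y : C) (f : mor X Y) : mor (G (F X)) (G (F Y)) :=
  fmor G (fmor F f).

Fact fcomp1 X : fcomp_mor (idm X) = idm (G (F X)).
Proof. by rewrite /fcomp_mor !fmor1. Qed.

Fact fcompM X Y Z (g : mor Y Z) (f : mor X Y) :
  fcomp_mor (g \oc f) = fcomp_mor g \oc fcomp_mor f.
Proof. by rewrite /fcomp_mor !fmorM. Qed.

Definition fcomp : functor C E :=
  @Functor C E (fun X => G (F X)) fcomp_mor fcomp1 fcompM.

End FunctorComp.

Definition nat_isomorphic (C D : preadditive) (F G : functor C D) : Prop :=
  exists eta : forall X, mor (F X) (G X),
    (forall X, is_iso (eta X)) /\
    (forall X Y (f : mor X Y), eta Y \oc fmor F f = fmor G f \oc eta X).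

(* [abHom A B] is [{additive A -> B}], renamed so as to carry the pointwise    *)
(* group structure.                                                            *)
Definition abHom (A B : zmodType) : Type := {additive A -> B}.

Definition ab_app (A B : zmodType) (f : abHom A B) : A -> B :=
  (f : {additive A -> B}).
Coercion ab_app : abHom >-> Funclass.

Definition ab_hom (A B : zmodType) (f : A -> B) (fB : zmod_morphism f) :
  abHom A B := HB.pack_for {additive A -> B} f (GRing.isZmodMorphism.Build A B f fB).

Lemma abHomP (A B : zmodType) (f g : abHom A B) : f =1 g -> f = g.
Proof.
case: f => f [[f0]]; case: g => g [[g0]] /funext; rewrite /ab_app /= => fg.
by subst g; rewrite (Prop_irrelevance f0 g0).
Qed.

HB.instance Definition _ (A B : zmodType) := gen_eqMixin (abHom A B).
HB.instance Definition _ (A B : zmodType) := gen_choiceMixin (abHom A B).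

Section AbHom.
Variables A B : zmodType.
Implicit Types f g h : abHom A B.

Lemma ab_appB f : zmod_morphism f. Proof. exact: raddfB. Qed.
Lemma ab_app0 f : f 0 = 0. Proof. exact: raddf0. Qed.
Lemma ab_appD f : {morph f : x y / x + y}. Proof. exact: raddfD. Qed.

Fact ab_zero_subproof : zmod_morphism (fun _ : A => 0 : B).
Proof. by move=> x y; rewrite subr0. Qed.

Fact ab_opp_subproof f : zmod_morphism (fun x => - f x).
Proof. by move=> x y; rewrite ab_appB opprD. Qed.

Fact ab_add_subproof f g : zmod_morphism (fun x => f x + g x).
Proof. by move=> x y; rewrite !ab_appB opprD addrACA. Qed.

Definition ab_zero : abHom A B := ab_hom ab_zero_subproof.
Definition ab_opp f : abHom A B := ab_hom (ab_opp_subproof f).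
Definition ab_add f g : abHom A B := ab_hom (ab_add_subproof f g).

Fact ab_addA : associative ab_add.
Proof. by move=> f g h; apply: abHomP => x; apply: addrA. Qed.
Fact ab_addC : commutative ab_add.
Proof. by move=> f g; apply: abHomP => x; apply: addrC. Qed.
Fact ab_add0 : left_id ab_zero ab_add.
Proof. by move=> f; apply: abHomP => x; apply: add0r. Qed.
Fact ab_addN : left_inverse ab_zero ab_opp ab_add.
Proof. by move=> f; apply: abHomP => x; apply: addNr. Qed.

HB.instance Definition _ :=
  GRing.isZmodule.Build (abHom A B) ab_addA ab_addC ab_add0 ab_addN.

End AbHom.

Fact ab_id_subproof (A : zmodType) : zmod_morphism (fun x : A => x).
Proof. by []. Qed.

Definition ab_id (A : zmodType) : abHom A A := ab_hom (@ab_id_subproof A).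

Fact ab_comp_subproof (A B D : zmodType) (g : abHom B D) (f : abHom A B) :
  zmod_morphism (fun x => g (f x)).
Proof. by move=> x y; rewrite !ab_appB. Qed.

Definition ab_comp (A B D : zmodType) (g : abHom B D) (f : abHom A B) :
  abHom A D := ab_hom (ab_comp_subproof g f).

Definition Ab_pre : preadditive.
Proof.
apply: (@Preadditive zmodType abHom ab_id ab_comp).
- by move=> *; apply: abHomP.
- by move=> *; apply: abHomP.
- by move=> *; apply: abHomP.
- by move=> *; apply: abHomP.
- by move=> A B D g f f'; apply: abHomP => x; apply: ab_appD.
Defined.

Fact Ab_zero : exists Z : Ab_pre, is_zero Z.
Proof.
exists ('I_1 : zmodType) => A; split=> f; apply: abHomP => x.
  by rewrite (ord1 x) !ab_app0.
by rewrite [LHS]ord1 [RHS]ord1.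
Qed.

Fact Ab_biproduct (A B : Ab_pre) :
  exists S (i1 : mor A S) (i2 : mor B S) p1 p2, is_biproduct i1 i2 p1 p2.
Proof.
have i1P : zmod_morphism (fun x : A => (x, 0 : B) : (A * B)%type).
  by move=> x y; congr pair; rewrite subr0.
have i2P : zmod_morphism (fun y : B => (0 : A, y) : (A * B)%type).
  by move=> x y; congr pair; rewrite subr0.
have p1P : zmod_morphism (fun z : (A * B)%type => z.1) by [].
have p2P : zmod_morphism (fun z : (A * B)%type => z.2) by [].
exists ((A * B)%type : zmodType), (ab_hom i1P), (ab_hom i2P).
exists (ab_hom p1P), (ab_hom p2P).
split; apply: abHomP => // -[x y].
by congr pair; [apply: addr0 | apply: add0r].
Qed.

Definition Ab_add : additive_cat := AdditiveCat Ab_zero Ab_biproduct.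

Lemma ab_factor (B D E : zmodType) (p : abHom B D) (u : abHom B E) :
    (forall q, exists y, p y = q) -> (forall y, p y = 0 -> u y = 0) ->
  exists! v : @mor Ab_pre D E, v \oc (p : @mor Ab_pre B D) = u.
Proof.
move=> psurj pu; pose s q := sval (cid (psurj q)).
have sK q : p (s q) = q by rewrite /s; case: cid.
have vE y : u (s (p y)) = u y.
  by apply/eqP; rewrite -subr_eq0 -ab_appB pu // ab_appB sK subrr.
have vP : zmod_morphism (fun q => u (s q)).
  by move=> x y; rewrite -ab_appB -[RHS]vE ab_appB !sK.
exists (ab_hom vP); split; first by apply: abHomP => y; apply: vE.
move=> v vu; apply: abHomP => q; rewrite -[RHS]/(v q) -[in RHS](sK q).
exact: (congr1 (fun h : abHom B E => h (s q)) (esym vu)).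
Qed.

Section AbKerCoker.
Variables (A B : zmodType) (f : abHom A B).

Definition ab_ker_pred : {pred A} := fun x => f x == 0.
Fact ab_ker_closed : zmod_closed ab_ker_pred.
Proof.
split=> [|x y]; rewrite !unfold_in ?ab_app0 //.
by rewrite ab_appB => /eqP -> /eqP ->; rewrite subr0.
Qed.
HB.instance Definition _ := GRing.isZmodClosed.Build A ab_ker_pred ab_ker_closed.

Definition ab_ker : Type := {x : A | ab_ker_pred x}.
HB.instance Definition _ := SubChoice.on ab_ker.
HB.instance Definition _ := [SubChoice_isSubZmodule of ab_ker by <:].

Fact ab_ker_subproof : zmod_morphism (val : ab_ker -> A).
Proof. by []. Qed.
Definition ab_ker_inc : abHom ab_ker A := ab_hom ab_ker_subproof.

Lemma ab_kernelP : is_kernel (f : @mor Ab_pre A B) (ab_ker_inc : @mor Ab_pre _ A).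
Proof.
split; first by apply: abHomP => -[x fx]; apply/eqP.
move=> Z u fu.
have uK z : ab_ker_pred (u z).
  by apply/eqP; have := congr1 (fun h : abHom Z B => h z) fu.
have vP : zmod_morphism (fun z => exist _ (u z) (uK z) : ab_ker).
  by move=> x y; apply: val_inj; apply: ab_appB.
exists (ab_hom vP); split; first exact: abHomP.
move=> v vu; apply: abHomP => z; apply: val_inj.
exact: (congr1 (fun h : abHom Z A => h z) (esym vu)).
Qed.

Definition ab_im_pred : {pred B} := fun y => `[< exists x, f x = y >].
Fact ab_im_closed : zmod_closed ab_im_pred.
Proof.
split=> [|x y]; first by apply/asboolP; exists 0; apply: ab_app0.
move=> /asboolP[a <-] /asboolP[b <-]; apply/asboolP; exists (a - b).
exact: ab_appB.
Qed.
HB.instance Definition _ := GRing.isZmodClosed.Build B ab_im_pred ab_im_closed.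

Definition ab_coker : zmodType := Quotient.quot ab_im_pred.

Definition ab_pi (y : B) : ab_coker := (\pi_(Quotient.quot ab_im_pred) y)%qT.

Fact ab_coker_subproof : zmod_morphism ab_pi.
Proof. exact: (pi_is_zmod_morphism (Quotient.quot ab_im_pred)). Qed.

Definition ab_coker_proj : abHom B ab_coker := ab_hom ab_coker_subproof.

Lemma ab_piP y : ab_coker_proj y = 0 <-> exists x, f x = y.
Proof.
rewrite -(ab_app0 ab_coker_proj); split.
  move=> /eqP py; apply/asboolP.
  have : ab_im_pred (y - 0).
    by have := Quotient.idealrBE ab_im_pred y 0; rewrite /in_mem /= => ->.
  by rewrite subr0.
move=> yim; apply/eqP; rewrite -[_ == _]/((y == 0 %[mod Quotient.quot ab_im_pred])%qT).
by rewrite -Quotient.idealrBE subr0; apply/asboolP.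
Qed.

Lemma ab_pi_surj q : exists y, ab_coker_proj y = q.
Proof. by exists (repr q)%qT; apply: (@reprK _ (Quotient.quot ab_im_pred)). Qed.

Lemma ab_cokernelP :
  is_cokernel (f : @mor Ab_pre A B) (ab_coker_proj : @mor Ab_pre B _).
Proof.
split; first by apply: abHomP => x; apply/ab_piP; exists x.
move=> Z u uf; apply: ab_factor; first exact: ab_pi_surj.
by move=> y /ab_piP[x <-]; have := congr1 (fun h : abHom A Z => h x) uf.
Qed.

Lemma ab_mono_kernel : is_mono (f : @mor Ab_pre A B) ->
  is_kernel (ab_coker_proj : @mor Ab_pre B _) (f : @mor Ab_pre A B).
Proof.
move=> fmono; split; first exact: ab_cokernelP.1.
have finj : injective f.
  move=> x y fxy.
  have Kxy : ab_ker_pred (x - y).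
    by apply/eqP; rewrite ab_appB fxy subrr.
  have fk : (f : @mor Ab_pre A B) \oc (ab_ker_inc : @mor Ab_pre _ A) =
      (f : @mor Ab_pre A B) \oc 0.
    apply: abHomP => -[z fz].
    by rewrite -[LHS]/(f z) (eqP fz) -[RHS]/(f 0) ab_app0.
  have := congr1 (fun h : abHom ab_ker A => h (exist _ (x - y) Kxy : ab_ker))
    (fmono _ _ _ fk).
  by move=> /eqP; rewrite -[_ == _]/(x - y == 0) subr_eq0 => /eqP.
move=> Z u pu.
have uim z : exists x, f x = u z.
  by apply/ab_piP; have := congr1 (fun h : abHom Z ab_coker => h z) pu.
pose v z := sval (cid (uim z)).
have vE z : f (v z) = u z by rewrite /v; case: cid.
have vP : zmod_morphism v.
  by move=> x y; apply: finj; rewrite [RHS]ab_appB !vE; apply: ab_appB.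
exists (ab_hom vP); split; first by apply: abHomP => z; apply: vE.
move=> v' v'u; apply: abHomP => z; apply: finj.
by rewrite -[LHS]/(f (v z)) vE -v'u.
Qed.

Lemma ab_epi_cokernel : is_epi (f : @mor Ab_pre A B) ->
  is_cokernel (ab_ker_inc : @mor Ab_pre _ A) (f : @mor Ab_pre A B).
Proof.
move=> fepi; split; first exact: ab_kernelP.1.
have fsurj y : exists x, f x = y.
  apply/ab_piP.
  have pif : (ab_coker_proj : @mor Ab_pre B _) \oc (f : @mor Ab_pre A B) =
      0 \oc (f : @mor Ab_pre A B).
    by apply: abHomP => x; apply/ab_piP; exists x.
  exact: (congr1 (fun h : abHom B ab_coker => h y) (fepi _ _ _ pif)).
move=> Z u uk.
apply: (ab_factor fsurj) => x /eqP fx.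
exact: (congr1 (fun h : abHom ab_ker Z => h (exist _ x fx : ab_ker)) uk).
Qed.

End AbKerCoker.

Fact Ab_has_kernel (X Y : Ab_add) (f : mor X Y) :
  exists K (k : mor K X), is_kernel f k.
Proof. by exists (ab_ker f : zmodType), (ab_ker_inc f); apply: ab_kernelP. Qed.

Fact Ab_has_cokernel (X Y : Ab_add) (f : mor X Y) :
  exists Q (q : mor Y Q), is_cokernel f q.
Proof. by exists (ab_coker f), (ab_coker_proj f); apply: ab_cokernelP. Qed.

Fact Ab_mono (X Y : Ab_add) (f : mor X Y) : is_mono f ->
  exists Z (g : mor Y Z), is_kernel g f.
Proof.
by move=> /ab_mono_kernel fk; exists (ab_coker f), (ab_coker_proj f).
Qed.

Fact Ab_epi (X Y : Ab_add) (f : mor X Y) : is_epi f ->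
  exists Z (g : mor Z X), is_cokernel g f.
Proof.
by move=> /ab_epi_cokernel fk; exists (ab_ker f : zmodType), (ab_ker_inc f).
Qed.

Definition Ab : abelian_cat :=
  AbelianCat Ab_has_kernel Ab_has_cokernel Ab_mono Ab_epi.

Section Representable.
Variables (C : preadditive) (I : C).

Fact rep_mor_subproof (X Y : C) (f : mor X Y) :
  zmod_morphism (fun g : mor Y I => g \oc f).
Proof.
move=> g h; apply/eqP; rewrite eq_sym subr_eq -cmpDl.
by rewrite addrNK.
Qed.

Definition rep_mor (X Y : C) (f : mor X Y) : @mor Ab (mor Y I) (mor X I) :=
  ab_hom (rep_mor_subproof f).

Fact rep_mor1 X : rep_mor (idm X) = idm (mor X I : Ab).
Proof. by apply: abHomP => g; apply: cmpm1. Qed.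

Fact rep_morM X Y Z (g : mor Y Z) (f : mor X Y) :
  rep_mor (g \oc f) = rep_mor f \oc rep_mor g.
Proof. by apply: abHomP => h; apply: cmpA. Qed.

Definition representable : cofunctor C Ab :=
  @Cofunctor C Ab (fun X => mor X I : Ab) rep_mor rep_mor1 rep_morM.

End Representable.

(* The shift is an additive autoequivalence, with a chosen quasi-inverse; it   *)
(* need not be a strict automorphism.  Verdier's axioms: TR1 is [dist_iso],    *)
(* [dist_id] and [dist_cone], TR2 is [dist_rot], TR3 is [dist_mor] and TR4     *)
(* (the octahedron) is [dist_oct].                                             *)
Record triangulated := Triangulated {
  tri_add :> additive_cat;
  shift : functor tri_add tri_add;
  unshift : functor tri_add tri_add;
  shift_additive : forall (X Y : tri_add) (f g : mor X Y),
    fmor shift (f + g) = fmor shift f + fmor shift g;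
  shiftK : nat_isomorphic (fcomp unshift shift) (fid tri_add);
  unshiftK : nat_isomorphic (fcomp shift unshift) (fid tri_add);
  dist : forall X Y Z : tri_add,
    mor X Y -> mor Y Z -> mor Z (shift X) -> Prop;
  dist_iso : forall (X Y Z X' Y' Z' : tri_add)
      (f : mor X Y) (g : mor Y Z) (h : mor Z (shift X))
      (f' : mor X' Y') (g' : mor Y' Z') (h' : mor Z' (shift X'))
      (a : mor X X') (b : mor Y Y') (c : mor Z Z'),
    is_iso a -> is_iso b -> is_iso c ->
    b \oc f = f' \oc a -> c \oc g = g' \oc b ->
    fmor shift a \oc h = h' \oc c ->
    dist f g h -> dist f' g' h';
  dist_id : forall X Z : tri_add, is_zero Z ->
    dist (idm X) (0 : mor X Z) (0 : mor Z (shift X));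
  dist_cone : forall (X Y : tri_add) (f : mor X Y),
    exists Z (g : mor Y Z) (h : mor Z (shift X)), dist f g h;
  dist_rot : forall (X Y Z : tri_add)
      (f : mor X Y) (g : mor Y Z) (h : mor Z (shift X)),
    dist f g h <-> dist g h (- fmor shift f);
  dist_mor : forall (X Y Z X' Y' Z' : tri_add)
      (f : mor X Y) (g : mor Y Z) (h : mor Z (shift X))
      (f' : mor X' Y') (g' : mor Y' Z') (h' : mor Z' (shift X'))
      (a : mor X X') (b : mor Y Y'),
    dist f g h -> dist f' g' h' -> b \oc f = f' \oc a ->
    exists c : mor Z Z',
      c \oc g = g' \oc b /\ fmor shift a \oc h = h' \oc c;
  dist_oct : forall (X Y Z X' Y' Z' : tri_add)
      (f : mor X Y) (a : mor Y Z') (a' : mor Z' (shift X))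
      (g : mor Y Z) (b : mor Z X') (b' : mor X' (shift Y))
      (c : mor Z Y') (c' : mor Y' (shift X)),
    dist f a a' -> dist g b b' -> dist (g \oc f) c c' ->
    exists (u : mor Z' Y') (v : mor Y' X'),
      [/\ dist u v (fmor shift a \oc b'),
          u \oc a = c \oc g, c' \oc u = a',
          v \oc c = b & b' \oc v = fmor shift f \oc c']
}.

Arguments shift {_}.
Arguments unshift {_}.
Arguments dist {_ X Y Z} f g h.

Section Triangulated.
Variable C : triangulated.

Definition shiftz (k : int) : functor C C :=
  match k with
  | Posz n => iter n (fcomp shift) (fid C)
  | Negz n => iter n.+1 (fcomp unshift) (fid C)
  end.

(* The class D[k], closed under isomorphism as the shift is only an            *)
(* equivalence.                                                                *)
Definition shifted_class (D : C -> Prop) (k : int) (X : C) : Prop :=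
  exists2 Y, D Y & isomorphic X (shiftz k Y).

Definition is_extension (E B A : C) : Prop :=
  exists (f : mor A E) (g : mor E B) (h : mor B (shift A)), dist f g h.

Definition right_orth (D : C -> Prop) (Y : C) : Prop :=
  forall X, D X -> forall f : mor X Y, f = 0.

Definition left_orth (E : C -> Prop) (X : C) : Prop :=
  forall Y, E Y -> forall f : mor X Y, f = 0.

Record torsion_theory := TorsionTheory {
  LO : C -> Prop;
  RO : C -> Prop;
  torsion_right : forall Y, right_orth LO Y <-> RO Y;
  torsion_left : forall X, LO X <-> left_orth RO X;
  torsion_dec : forall M, exists L R, [/\ LO L, RO R & is_extension M R L]
}.

Record weight_structure := WeightStructure {
  weight_torsion :> torsion_theory;
  weight_shift : forall X,
    LO weight_torsion X -> shifted_class (LO weight_torsion) 1 X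
}.

Section Weight.
Variable w : weight_structure.

Definition w_le (k : int) : C -> Prop := shifted_class (LO w) k.

Definition w_ge (k : int) : C -> Prop :=
  shifted_class (shifted_class (RO w) (- 1)) k.

Record weight_dec (k : int) (X : C) := WeightDec {
  wle : C;
  wge : C;
  wle_in : w_le k wle;
  wge_in : w_ge (k + 1) wge;
  wle_mor : mor wle X;
  wge_mor : mor X wge;
  wbd : mor wge (shift wle);
  weight_dist : dist wle_mor wge_mor wbd
}.

(* g extends to a morphism (c, g, d) of triangles from D to E; c always exists *)
(* when k <= l, and is unique when k < l.                                      *)
Definition wle_extends (X Y : C) (g : mor X Y) (k l : int)
    (D : weight_dec k X) (E : weight_dec l Y) (c : mor (wle D) (wle E)) : Prop :=
  exists d : mor (wge D) (wge E),
    [/\ wle_mor E \oc c = g \oc wle_mor D,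
        wge_mor E \oc g = d \oc wge_mor D
      & wbd E \oc d = fmor shift c \oc wbd D].

Definition wle_connecting (X : C) (k l : int)
    (D : weight_dec k X) (E : weight_dec l X) (c : mor (wle D) (wle E)) : Prop :=
  wle_extends (idm X) c.

(* A choice of w_{>= m} N comes from an (m - 1)-weight decomposition of N. *)
Definition kills_weights (m n : int) (M N : C) (g : mor M N) : Prop :=
  exists (D : weight_dec n M) (E : weight_dec (m - 1) N),
    wge_mor E \oc g \oc wle_mor D = 0.

Definition without_weights (m n : int) (M : C) : Prop :=
  kills_weights m n (idm M).

(* V is the value of tau_{<= k}(H) at X, for some choice of weight             *)
(* decompositions; different choices give isomorphic values.                   *)
Definition virtual_trunc (A : abelian_cat) (k : int) (H : cofunctor C A)
    (X : C) (V : A) : Prop :=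
  exists (D : weight_dec k X) (E : weight_dec (k + 1) X)
    (c : mor (wle D) (wle E)) (i : mor V (H (wle D))),
    wle_connecting c /\ is_image (comor H c) i.

Definition weight_range (A : abelian_cat) (m n : int) (H : cofunctor C A) :
    Prop :=
  (forall X, w_le (m - 1) X -> is_zero (H X)) /\
  (forall X, w_ge (n + 1) X -> is_zero (H X)).

End Weight.

(* Exactness of                                                                *)
(*   H(Y[1][i]) -> H(X[1][i]) -> H(Z[i]) -> H(Y[i]) -> H(X[i])                 *)
(* at its three inner terms, for every integer i, is exactness of the whole    *)
(* long sequence.                                                              *)
Definition cohomological (A : abelian_cat) (H : cofunctor C A) : Prop :=
  forall (X Y Z : C) (f : mor X Y) (g : mor Y Z) (h : mor Z (shift X)),
    dist f g h -> forall i : int,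
    [/\ exact (comor H (fmor (shiftz i) g)) (comor H (fmor (shiftz i) f)),
        exact (comor H (fmor (shiftz i) h)) (comor H (fmor (shiftz i) g))
      & exact (comor H (fmor (shiftz i) (fmor shift f)))
              (comor H (fmor (shiftz i) h))].

End Triangulated.

(* Main.v *)
From HB Require Import structures.
Require Import Defs.
From mathcomp Require Import all_boot all_order all_algebra.
From mathcomp Require Import boolp.
Import GRing.Theory Num.Theory.
Local Open Scope ring_scope.
Local Open Scope cat_scope.
Set Implicit Arguments.
Unset Strict Implicit.
Unset Printing Implicit Defensive.

(** The theorem rests on orthogonality: an object of weights at most [j] has no
    nonzero morphism to an object of weights at least [k] when [j < k]
    ([w_orth]).  Hence a morphism from an object of weights at most [k] to [X]
    lifts to the truncation [wle D] of any k-weight decomposition [D] of [X]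
    ([wle_lift]), and the lift is unique when the source has weights less than
    [k] ([wle_inj]).

    Let M be without weights m, ..., n; write w_n and w_(m-1) for truncations of
    M.  The vanishing of w_n -> M -> w_(>= m) M says that w_n -> M factors
    through w_(m-1) -> M by some c : w_n -> w_(m-1)
    ([without_weights_factor]).  Push the triangle w_n -> M -> B -> w_n[1] out
    along c: this gives an extension of B by w_(m-1), and M is a retract of it,
    because w_(m-1) -> M extends to the pushout
    ([without_weights_retract]).  A cohomological functor of weight range [m, n]
    kills both ends of this extension, hence its retract M
    ([retract_extension_zero]).

    To use the vanishing of all such functors one needs enough of them, and the
    virtual truncations of the functors represented by I of weights at least m
    suffice.  To have functoriality for free, let the truncation of H_I at
    X be the group of natural transformations from C(-, X) to
    C(-, I), both restricted to objects of weights at most n.  By Yoneda and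
    [wle_lift] this is the group of those phi : w_n X -> I which kill every
    l : L -> w_n X, with L of weights at most n, that becomes zero in X
    ([trunc]).  Exactness
    ([truncation_cohomological]) comes from building, for a triangle
    X -> Y -> Z, an object E of weights at most n in a triangle
    w_n X -> E -> w_n Z over the given one, and extending along E -> w_n Z.
    A value of the virtual truncation is the image of
    C(w_(n+1) M, I) -> C(w_n M, I), and every element of that image lies in
    [trunc] ([truncation_virtual]).  Conversely, for I = w_(>= m) M the
    composition w_n M -> M -> I is itself in the image, as it factors through
    w_(n+1) M; if the image vanishes then M is without weights m, ..., n
    ([trunc_zero_without_weights]).

    Suppose now that idempotents split.  With c as above and
    c0 : w_(m-1) -> w_n the connecting morphism, uniqueness of lifts gives
    c0 c c0 = c0, so c c0 is an idempotent of w_(m-1).  Its image A has weights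
    at most m - 1, every morphism to M from an object of weights at most n
    factors through A, and this forces the cone of A -> M to have weights at
    least n + 1 ([without_weights_extension]).  The triangle so obtained is both
    an (m - 1)- and an n-weight decomposition of M, and the remaining
    implications are immediate. *)

(** * Preadditive categories *)

Section PreadditiveTheory.
Variable C : preadditive.
Implicit Types X Y Z : C.

Lemma cmp0m X Y Z (f : mor X Y) : (0 : mor Y Z) \oc f = 0.
Proof. by apply: (addrI ((0 : mor Y Z) \oc f)); rewrite -cmpDl !addr0. Qed.

Lemma cmpm0 X Y Z (g : mor Y Z) : g \oc (0 : mor X Y) = 0.
Proof. by apply: (addrI (g \oc (0 : mor X Y))); rewrite -cmpDr !addr0. Qed.

Lemma cmpNm X Y Z (g : mor Y Z) (f : mor X Y) : (- g) \oc f = - (g \oc f).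
Proof. by apply: (addrI (g \oc f)); rewrite -cmpDl !subrr cmp0m. Qed.

Lemma cmpmN X Y Z (g : mor Y Z) (f : mor X Y) : g \oc (- f) = - (g \oc f).
Proof. by apply: (addrI (g \oc f)); rewrite -cmpDr !subrr cmpm0. Qed.

Lemma cmpBl X Y Z (g g' : mor Y Z) (f : mor X Y) :
  (g - g') \oc f = g \oc f - g' \oc f.
Proof. by rewrite cmpDl cmpNm. Qed.

Lemma cmpBr X Y Z (g : mor Y Z) (f f' : mor X Y) :
  g \oc (f - f') = g \oc f - g \oc f'.
Proof. by rewrite cmpDr cmpmN. Qed.

Lemma is_zeroP X : is_zero X <-> idm X = 0.
Proof.
split=> [/(_ X)[/(_ (idm X))] //|X0 Y].
by split=> f; [rewrite -[f]cmpm1 | rewrite -[f]cmp1m];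
   rewrite X0 ?cmpm0 ?cmp0m.
Qed.

Lemma retract_zero X Y : retract X Y -> is_zero Y -> is_zero X.
Proof.
move=> [i [p pi1]] /is_zeroP Y0; apply/is_zeroP.
by rewrite -pi1 -[p]cmpm1 Y0 cmpm0 cmp0m.
Qed.

Lemma is_iso_idm X : is_iso (idm X).
Proof. by exists (idm X); rewrite cmp1m. Qed.

Lemma is_iso_oppm X : is_iso (- idm X).
Proof. by exists (- idm X); rewrite cmpNm cmpmN opprK cmp1m. Qed.

Lemma isomorphic_refl X : isomorphic X X.
Proof. by exists (idm X); apply: is_iso_idm. Qed.

Lemma isomorphic_sym X Y : isomorphic X Y -> isomorphic Y X.
Proof. by move=> [f [g [gf fg]]]; exists g, f. Qed.

Lemma isomorphic_trans X Y Z :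
  isomorphic X Y -> isomorphic Y Z -> isomorphic X Z.
Proof.
move=> [f [g [gf fg]]] [f' [g' [gf' fg']]].
exists (f' \oc f), (g \oc g'); split.
  by rewrite cmpA -(cmpA g) gf' cmpm1.
by rewrite cmpA -(cmpA f') fg cmpm1.
Qed.

Definition orth X Y : Prop := forall f : mor X Y, f = 0.

Lemma orth_isol X X' Y : isomorphic X X' -> orth X Y -> orth X' Y.
Proof.
by move=> [f [g [_ fg]]] XY u; rewrite -[u]cmpm1 -fg cmpA (XY (u \oc f)) cmp0m.
Qed.

Lemma orth_isor X Y Y' : isomorphic Y Y' -> orth X Y -> orth X Y'.
Proof.
by move=> [f [g [_ fg]]] XY u; rewrite -[u]cmp1m -fg -cmpA (XY (g \oc u)) cmpm0.
Qed.

End PreadditiveTheory.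

(** * Equivalences of preadditive categories *)

Section Functors.

Definition faithful (C D : preadditive) (F : functor C D) : Prop :=
  forall (X Y : C) (f g : mor X Y), fmor F f = fmor F g -> f = g.

Definition full (C D : preadditive) (F : functor C D) : Prop :=
  forall (X Y : C) (u : mor (F X) (F Y)), exists f, fmor F f = u.

Lemma fob_isomorphic (C D : preadditive) (F : functor C D) (X Y : C) :
  isomorphic X Y -> isomorphic (F X) (F Y).
Proof.
move=> [f [g [gf fg]]]; exists (fmor F f), (fmor F g).
by rewrite -!fmorM gf fg !fmor1.
Qed.

Lemma full_comp (C D E : preadditive) (G : functor D E) (F : functor C D) :
  full G -> full F -> full (fcomp G F).
Proof.
move=> Gf Ff X Y u; have [v <-] := Gf _ _ u.
by have [f <-] := Ff _ _ v; exists f.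
Qed.

Lemma faithful_comp (C D E : preadditive) (G : functor D E) (F : functor C D) :
  faithful G -> faithful F -> faithful (fcomp G F).
Proof. by move=> Gf Ff X Y f g /Gf /Ff. Qed.

Lemma quasi_inverse_faithful (C D : preadditive) (F : functor C D)
    (G : functor D C) : nat_isomorphic (fcomp G F) (fid C) -> faithful F.
Proof.
move=> [eta [etaI etaN]] X Y f g fg.
have [e [_ He]] := etaI X.
rewrite -[f]cmpm1 -[g]cmpm1 -He !cmpA.
rewrite -(etaN _ _ f : eta Y \oc _ = f \oc _).
by rewrite -(etaN _ _ g : eta Y \oc _ = g \oc _) /= fg.
Qed.

(** The preimage of [u] is [G u] conjugated by the natural isomorphism; that it
    maps to [u] can be checked after applying [G]. *)
Lemma quasi_inverse_full (C D : preadditive) (F : functor C D)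
    (G : functor D C) : nat_isomorphic (fcomp G F) (fid C) ->
  faithful G -> full F.
Proof.
move=> [eta [etaI etaN]] GF X Y u.
have [e [eK Ke]] := etaI X; have [e' [e'K _]] := etaI Y.
exists (eta Y \oc fmor G u \oc e : mor X Y); apply: GF.
set f := (X in fmor F X).
have fE : eta Y \oc fmor G (fmor F f) = eta Y \oc fmor G u.
  rewrite [LHS](etaN X Y f) -[RHS]cmpm1 -eK [RHS]cmpA.
  by congr (_ \oc _).
by rewrite -[LHS]cmp1m -[RHS]cmp1m -e'K -!cmpA; congr (_ \oc _).
Qed.

Lemma nat_isomorphicP (C D : preadditive) (F G : functor C D) :
  nat_isomorphic F G -> forall X, isomorphic (F X) (G X).
Proof. by move=> [eta [etaI _]] X; exists (eta X). Qed.

End Functors.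

(** * Distinguished triangles *)

Section Triangles.
Variable C : triangulated.
Implicit Types X Y Z W : C.

Lemma shift_faithful : faithful (@shift C).
Proof. exact: (quasi_inverse_faithful (@shiftK C)). Qed.

Lemma unshift_faithful : faithful (@unshift C).
Proof. exact: (quasi_inverse_faithful (@unshiftK C)). Qed.

Lemma shift_full : full (@shift C).
Proof. exact: (quasi_inverse_full (@shiftK C) unshift_faithful). Qed.

Lemma unshift_full : full (@unshift C).
Proof. exact: (quasi_inverse_full (@unshiftK C) shift_faithful). Qed.

Lemma shift0 X Y : fmor shift (0 : mor X Y) = 0.
Proof.
apply: (addrI (fmor shift (0 : mor X Y))).
by rewrite -shift_additive !addr0.
Qed.

Lemma shiftN X Y (f : mor X Y) : fmor shift (- f) = - fmor shift f.
Proof.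
by apply: (addrI (fmor shift f)); rewrite -shift_additive !subrr shift0.
Qed.

Lemma unshift0 X Y : fmor unshift (0 : mor X Y) = 0.
Proof.
have [eta [etaI etaN]] := @unshiftK C.
apply: shift_faithful; rewrite shift0.
have [e [eK _]] := etaI Y.
by rewrite -[LHS]cmp1m -eK -cmpA (etaN _ _ (0 : mor X Y)) cmp0m cmpm0.
Qed.

(** Map the triangle on [idm X], whose cone is zero, to the given one. *)
Lemma dist_comp0 X Y Z (f : mor X Y) (g : mor Y Z) h :
  dist f g h -> g \oc f = 0.
Proof.
move=> fgh; have [Z0 zero] := additive_zero C.
have [c [<- _]] := dist_mor (dist_id X zero) fgh (erefl (f \oc idm X)).
exact: cmpm0.
Qed.

(** Morphisms out of [W] turn a triangle into an exact sequence: a morphism from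
    the triangle on [idm W] to the given one is the lift. *)
Lemma dist_lift W X Y Z (f : mor X Y) (g : mor Y Z) h (u : mor W Y) :
  dist f g h -> g \oc u = 0 -> exists v : mor W X, f \oc v = u.
Proof.
move=> /dist_rot fgh gu; have [Z0 zero] := additive_zero C.
have /dist_rot iW := dist_id W zero.
have [|c [_]] := dist_mor (a := u) (b := 0 : mor Z0 Z) iW fgh.
  by rewrite gu cmpm0.
have [v <-] := shift_full c.
rewrite fmor1 cmpmN cmpm1 cmpNm => /oppr_inj.
rewrite -fmorM => /shift_faithful ->.
by exists v.
Qed.

(** The dual exactness, for morphisms into [W]. *)
Lemma dist_extend W X Y Z (f : mor X Y) (g : mor Y Z) h (u : mor Y W) :
  dist f g h -> u \oc f = 0 -> exists v : mor Z W, v \oc g = u.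
Proof.
move=> fgh uf; have [Z0 zero] := additive_zero C.
have zeroS : is_zero (shift Z0).
  by apply/is_zeroP; rewrite -fmor1 (is_zeroP _).1 // shift0.
have iW : dist (0 : mor Z0 W) (idm W) 0.
  by apply/dist_rot; rewrite shift0 oppr0; apply: dist_id.
have [|c [cg _]] := dist_mor (a := 0 : mor X Z0) (b := u) fgh iW.
  by rewrite uf cmpm0.
by exists c; rewrite cg cmp1m.
Qed.

(** Rotating twice makes two signs appear, which cancel through the
    automorphism [- idm] of the last object. *)
Lemma dist_rotN X Y Z (f : mor X Y) (g : mor Y Z) h :
  dist f g h -> dist h (fmor shift f) (fmor shift g).
Proof.
move=> /dist_rot /dist_rot fgh.
apply: (dist_iso (is_iso_idm _) (is_iso_idm _) (is_iso_oppm _) _ _ _ fgh).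
- by rewrite cmp1m cmpm1.
- by rewrite cmpNm cmpmN opprK cmp1m cmpm1.
- by rewrite fmor1 !cmpmN cmp1m cmpm1.
Qed.

Lemma dist_lift_shift W X Y Z (f : mor X Y) (g : mor Y Z) h
    (u : mor W (shift X)) :
  dist f g h -> fmor shift f \oc u = 0 -> exists v : mor W Z, h \oc v = u.
Proof. by move=> /dist_rotN; apply: dist_lift. Qed.

Lemma dist_extend_shift W X Y Z (f : mor X Y) (g : mor Y Z) h (u : mor X W) :
  dist f g h -> fmor shift u \oc h = 0 -> exists v : mor Y W, v \oc f = u.
Proof.
move=> /dist_rotN T /(dist_extend T)[v]; have [v' <-] := shift_full v.
by rewrite -fmorM => /shift_faithful; exists v'.
Qed.

(** The five lemma, read in the long exact sequences of morphisms into the two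
    triangles: it gives injectivity of composition with [c] and a right inverse
    of [c], and these two make [c] invertible. *)
Lemma dist_iso3 X Y Z X' Y' Z' (f : mor X Y) (g : mor Y Z) h
    (f' : mor X' Y') (g' : mor Y' Z') h'
    (a : mor X X') (b : mor Y Y') (c : mor Z Z') :
  dist f g h -> dist f' g' h' -> is_iso a -> is_iso b ->
  b \oc f = f' \oc a -> c \oc g = g' \oc b -> fmor shift a \oc h = h' \oc c ->
  is_iso c.
Proof.
move=> T T' [a' [a'a aa']] [b' [b'b bb']] bf cg ah.
have T1 := (dist_rot f g h).1 T.
have T2 := (dist_rot g h _).1 T1.
(* [T1] and [T2] are rotations of [T], giving exactness at [Z] and [shift X]. *)
have c_inj W (u : mor W Z) : c \oc u = 0 -> u = 0.
  move=> cu; have hu : h \oc u = 0.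
    rewrite -[h]cmp1m -fmor1 -a'a fmorM -(cmpA (fmor _ a')) ah -!cmpA cu.
    by rewrite !cmpm0.
  have [v uE] := dist_lift T1 hu.
  have [|x bv] := dist_lift (u := b \oc v) T'.
    by rewrite cmpA -cg -cmpA uE cu.
  have -> : u = g \oc f \oc (a' \oc x).
    rewrite -uE -cmpA; congr (g \oc _).
    rewrite -[v]cmp1m -b'b -cmpA -bv -(cmp1m (f \oc _)) -b'b -(cmpA b').
    by rewrite (cmpA b f) bf (cmpA _ a' x) -(cmpA f') aa' cmpm1.
  by rewrite (dist_comp0 T) cmp0m.
have [z hz] : exists z : mor Z' Z, h \oc z = fmor shift a' \oc h'.
  apply: (dist_lift T2); rewrite cmpNm cmpA -fmorM.
  have -> : f \oc a' = b' \oc f'.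
    by rewrite -[f']cmpm1 -aa' (cmpA f') -bf -cmpA (cmpA b') b'b cmp1m.
  rewrite fmorM -cmpA.
  have /oppr_inj : - (fmor shift f' \oc h') = - 0.
    rewrite -cmpNm oppr0; apply: dist_comp0.
    exact: (dist_rot _ _ _).1 ((dist_rot _ _ _).1 T').
  by move=> ->; rewrite cmpm0 oppr0.
have [t tE] : exists t : mor Z' Y', g' \oc t = idm Z' - c \oc z.
  apply: (dist_lift ((dist_rot f' g' h').1 T')).
  by rewrite cmpBr cmpm1 cmpA -ah -cmpA hz cmpA -fmorM aa' fmor1 cmp1m subrr.
have [r cr] : exists r, c \oc r = idm Z'.
  exists (z + g \oc (b' \oc t)).
  rewrite cmpDr (cmpA c) cg -(cmpA g') (cmpA b) bb' cmp1m tE.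
  by rewrite addrC subrK.
exists r; split=> //; apply/eqP; rewrite -subr_eq0; apply/eqP/c_inj.
by rewrite cmpBr cmpA cr cmp1m cmpm1 subrr.
Qed.

(** Every morphism to a shift is the third one of a triangle: the cone of [d] is
    the shift of the wanted object up to isomorphism, as the shift is an
    equivalence. *)
Lemma dist_cocone X Z (d : mor Z (shift X)) :
  exists Y (p : mor X Y) (q : mor Y Z), dist p q d.
Proof.
have [W [e [k T]]] := dist_cone d.
have [a a_iso] := isomorphic_sym (nat_isomorphicP (@unshiftK C) W).
have [a' [a'a aa']] := a_iso.
have [p pE] := shift_full (a \oc e : mor (shift X) (shift (unshift W))).
have [q qE] := shift_full (k \oc a' : mor (shift (unshift W)) (shift Z)).
exists (unshift W), (- p), (- q).
apply/dist_rot/dist_rot; rewrite !shiftN !opprK.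
apply: (dist_iso (is_iso_idm _) (is_iso_idm _) a_iso _ _ _ T).
- by rewrite cmp1m cmpm1.
- by rewrite cmpm1 pE.
- by rewrite qE fmor1 cmp1m -cmpA a'a cmpm1.
Qed.

(** The axiom on morphisms of triangles, with the second component to be found
    instead of the third. *)
Lemma dist_mor2 X Y Z X' Y' Z' (f : mor X Y) (g : mor Y Z) h
    (f' : mor X' Y') (g' : mor Y' Z') h' (a : mor X X') (c : mor Z Z') :
    dist f g h -> dist f' g' h' -> fmor shift a \oc h = h' \oc c ->
  exists b : mor Y Y', b \oc f = f' \oc a /\ c \oc g = g' \oc b.
Proof.
move=> /dist_rotN T /dist_rotN T' ah.
have [b] := dist_mor T T' ah; have [b' <-] := shift_full b.
rewrite -!fmorM => -[/shift_faithful bf /shift_faithful cg].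
by exists b'.
Qed.

(** The third morphism is left free: shifting changes its sign, and its target
    is identified with a shift only through the natural isomorphisms. *)
Definition preserves_dist (F : functor C C) : Prop :=
  forall X Y Z (f : mor X Y) (g : mor Y Z) h, dist f g h ->
    exists h', dist (fmor F f) (fmor F g) h'.

Lemma shift_dist : preserves_dist shift.
Proof.
move=> X Y Z f g h /dist_rot /dist_rot /dist_rot T.
exists (- fmor shift h).
apply: (dist_iso (is_iso_idm _) (is_iso_oppm _) (is_iso_idm _) _ _ _ T).
- by rewrite cmpNm cmpmN opprK cmp1m cmpm1.
- by rewrite !cmpmN cmp1m cmpm1.
- by rewrite fmor1 cmp1m cmpm1.
Qed.

(** A cone of [unshift f] becomes, after shifting, a cone of [f]; the five lemma
    identifies it with [Z], and full faithfulness of the shift carries this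
    identification back. *)
Lemma unshift_dist : preserves_dist unshift.
Proof.
move=> X Y Z f g h T.
have [eta [etaI etaN]] := @unshiftK C.
have [W [g0 [h0 T0]]] := dist_cone (fmor unshift f).
have [h1 T1] := shift_dist T0.
have [c [cg ch]] := dist_mor T1 T (etaN X Y f).
have [c' [c'c cc']] := dist_iso3 T1 T (etaI X) (etaI Y) (etaN X Y f) cg ch.
have [e [eK Ke]] := etaI Z.
have [d dE] := shift_full (e \oc c : mor (shift W) (shift (unshift Z))).
have [d' d'E] := shift_full (c' \oc eta Z : mor (shift (unshift Z)) (shift W)).
have d'd : d' \oc d = idm W.
  apply: shift_faithful; rewrite fmorM d'E dE fmor1 -c'c -cmpA.
  by congr (c' \oc _); rewrite cmpA Ke cmp1m.
have dd' : d \oc d' = idm (unshift Z).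
  apply: shift_faithful; rewrite fmorM d'E dE fmor1 -eK -cmpA.
  by congr (e \oc _); rewrite cmpA cc' cmp1m.
exists (h0 \oc d').
have d_iso : is_iso d by exists d'.
apply: (dist_iso (is_iso_idm _) (is_iso_idm _) d_iso _ _ _ T0).
- by rewrite cmp1m cmpm1.
- rewrite cmpm1; apply: shift_faithful; rewrite fmorM dE -cmpA cg.
  rewrite -[RHS]cmp1m -eK -cmpA; congr (e \oc _).
  by symmetry; apply: (etaN Y Z g).
- by rewrite fmor1 cmp1m -cmpA d'd cmpm1.
Qed.

Lemma preserves_dist_comp (G F : functor C C) :
  preserves_dist G -> preserves_dist F -> preserves_dist (fcomp G F).
Proof. by move=> GT FT X Y Z f g h /FT[h' /GT]. Qed.

(** What holds for the identity and is kept by composing with the shift and its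
    quasi-inverse holds for every power of the shift. *)
Lemma shiftz_ind (P : functor C C -> Prop) :
    P (fid C) -> (forall F, P F -> P (fcomp shift F)) ->
    (forall F, P F -> P (fcomp unshift F)) ->
  forall k, P (shiftz C k).
Proof.
move=> P0 PS PU [] n; first by elim: n => //= n; apply: PS.
by rewrite /shiftz; elim: n.+1 => //= {}n; apply: PU.
Qed.

Lemma shiftz_faithful k : faithful (shiftz C k).
Proof.
apply: (@shiftz_ind (@faithful C C)) => [X Y f g //|F|F]; apply: faithful_comp.
  exact: shift_faithful.
exact: unshift_faithful.
Qed.

Lemma shiftz_full k : full (shiftz C k).
Proof.
apply: (@shiftz_ind (@full C C)) => [X Y f|F|F]; first by exists f.
  by apply: full_comp; apply: shift_full.
by apply: full_comp; apply: unshift_full.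
Qed.

Lemma shiftz_dist k : preserves_dist (shiftz C k).
Proof.
apply: (@shiftz_ind preserves_dist) => [X Y Z f g h|F|F]; first by exists h.
  by apply: preserves_dist_comp; apply: shift_dist.
by apply: preserves_dist_comp; apply: unshift_dist.
Qed.

Lemma shiftz0m k X Y : fmor (shiftz C k) (0 : mor X Y) = 0.
Proof.
apply: (@shiftz_ind (fun F => fmor F (0 : mor X Y) = 0)) => //= F ->.
  exact: shift0.
exact: unshift0.
Qed.

Lemma orth_shiftz k X Y : orth (shiftz C k X) (shiftz C k Y) <-> orth X Y.
Proof.
split=> XY f; first by apply: (@shiftz_faithful k); rewrite shiftz0m.
by have [f' <-] := shiftz_full f; rewrite (XY f') shiftz0m.
Qed.

Lemma shiftzS k X : isomorphic (shiftz C (k + 1) X) (shift (shiftz C k X)).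
Proof.
case: k => n; first by rewrite -PoszD addn1; apply: isomorphic_refl.
apply: isomorphic_sym.
have -> : (Negz n + 1)%R = - n%:Z by rewrite NegzE -addn1 PoszD opprD subrK.
case: n => [|n]; exact: (nat_isomorphicP (@unshiftK C)).
Qed.

Lemma shiftzB k X : isomorphic (shiftz C (k - 1) X) (unshift (shiftz C k X)).
Proof.
have /(fob_isomorphic unshift) := shiftzS (k - 1) X; rewrite subrK => kX.
apply: isomorphic_sym; apply: isomorphic_trans kX _.
exact: (nat_isomorphicP (@shiftK C) (shiftz C (k - 1) X)).
Qed.

(** The objects are isomorphic rather than equal: with [j] and [k] of opposite
    signs the shift has to be cancelled against its quasi-inverse. *)
Lemma shiftzD j k X :
  isomorphic (shiftz C (j + k) X) (shiftz C j (shiftz C k X)).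
Proof.
have step i : isomorphic (shiftz C (i + k) X) (shiftz C i (shiftz C k X)) ->
    isomorphic (shiftz C (i + 1 + k) X) (shiftz C (i + 1) (shiftz C k X)) /\
    isomorphic (shiftz C (i - 1 + k) X) (shiftz C (i - 1) (shiftz C k X)).
  move=> IH; rewrite (addrAC i 1) (addrAC i (- 1)); split.
    apply: isomorphic_trans (shiftzS _ _) _.
    apply: isomorphic_trans _ (isomorphic_sym (shiftzS _ _)).
    exact: fob_isomorphic.
  apply: isomorphic_trans (shiftzB _ _) _.
  apply: isomorphic_trans _ (isomorphic_sym (shiftzB _ _)).
  exact: fob_isomorphic.
elim/int_ind: j => [|n /step[IH _]|n /step[_ IH]].
- by rewrite add0r; apply: isomorphic_refl.
- by rewrite -addn1 PoszD.
- by rewrite -addn1 PoszD opprD.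
Qed.

End Triangles.

(** * Weights *)

Section Weights.
Variables (C : triangulated) (w : weight_structure C).
Implicit Types (X Y Z L : C) (j k : int).

Definition iso_closed (D : C -> Prop) : Prop :=
  forall X Y, isomorphic X Y -> D X -> D Y.

Lemma shiftzK k X : isomorphic (shiftz C (- k) (shiftz C k X)) X.
Proof. by have := isomorphic_sym (shiftzD (- k) k X); rewrite addNr. Qed.

Lemma shiftzNK k X : isomorphic (shiftz C k (shiftz C (- k) X)) X.
Proof. by have := isomorphic_sym (shiftzD k (- k) X); rewrite addrN. Qed.

Lemma shifted_classP D k X : iso_closed D ->
  shifted_class D k X <-> D (shiftz C (- k) X).
Proof.
move=> Diso; split=> [[Y DY XY]|DX].
  apply: Diso DY; apply: isomorphic_trans (isomorphic_sym (shiftzK k Y)) _.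
  exact/fob_isomorphic/isomorphic_sym.
by exists (shiftz C (- k) X) => //; apply/isomorphic_sym/shiftzNK.
Qed.

Lemma shifted_class_iso D k : iso_closed (shifted_class D k).
Proof.
move=> X Y XY [Z DZ XZ]; exists Z => //.
exact: isomorphic_trans (isomorphic_sym XY) XZ.
Qed.

Lemma LO_iso : iso_closed (LO w).
Proof.
move=> X Y XY /torsion_left XO; apply/torsion_left => Z RZ.
exact: orth_isol XY (XO Z RZ).
Qed.

Lemma RO_iso : iso_closed (RO w).
Proof.
move=> X Y XY /torsion_right XO; apply/torsion_right => Z LZ.
exact: orth_isor XY (XO Z LZ).
Qed.

Lemma w_leP k X : w_le w k X <-> LO w (shiftz C (- k) X).
Proof. exact/shifted_classP/LO_iso. Qed.

(** The classes [w_ge] carry a shift by [- 1] relative to [RO], whence the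
    [k + 1] against [k]. *)
Lemma w_geP k X : w_ge w (k + 1) X <-> RO w (shiftz C (- k) X).
Proof.
have E : isomorphic (shiftz C (- k) X)
    (shiftz C (- -1) (shiftz C (- (k + 1)) X)).
  by have := shiftzD (- -1) (- (k + 1)) X; rewrite opprD addrCA addrN addr0.
apply: iff_trans (shifted_classP _ _ (@shifted_class_iso _ _)) _.
apply: iff_trans (shifted_classP _ _ RO_iso) _.
split; apply: RO_iso; [exact: isomorphic_sym | exact: E].
Qed.

Lemma w_le_iso k : iso_closed (w_le w k).
Proof. exact: shifted_class_iso. Qed.

(** Both classes of a weight structure are determined by each other through
    orthogonality, in every weight. *)
Lemma w_leE k X : w_le w k X <-> forall Y, w_ge w (k + 1) Y -> orth X Y.
Proof.
split=> [/w_leP XL Y /w_geP YR|XO].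
  by apply/(orth_shiftz (- k)); apply: (torsion_left _ _).1 YR.
apply/w_leP/torsion_left => R RR.
apply: orth_isor (shiftzK k R) _; apply/orth_shiftz/XO/w_geP.
exact: RO_iso (isomorphic_sym (shiftzK k R)) RR.
Qed.

Lemma w_geE k Y : w_ge w (k + 1) Y <-> forall X, w_le w k X -> orth X Y.
Proof.
split=> [YR X /w_leE XO|YO]; first exact: XO.
apply/w_geP/torsion_right => L LL.
apply: orth_isol (shiftzK k L) _; apply/orth_shiftz/YO/w_leP.
exact: LO_iso (isomorphic_sym (shiftzK k L)) LL.
Qed.

Lemma w_le_leq j k X : j <= k -> w_le w j X -> w_le w k X.
Proof.
move=> jk; rewrite -[k](subrK j) addrC.
have -> : k - j = `|k - j|%N by rewrite gez0_abs // subr_ge0.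
elim: `|k - j|%N => [|i IH] Xj; first by rewrite addr0.
rewrite -addn1 PoszD addrA; apply/w_leP.
have /w_leP/weight_shift/(shifted_classP _ _ LO_iso) := IH Xj.
apply: LO_iso; apply: isomorphic_sym.
by have := shiftzD (- 1) (- (j + i)) X; rewrite -opprD (addrC 1).
Qed.

Lemma w_ge_leq j k X : k <= j -> w_ge w j X -> w_ge w k X.
Proof.
rewrite -{1 2}[j](subrK 1) -[k](subrK 1) lerD2r => kj /w_geE XO.
by apply/w_geE => L /(w_le_leq kj); apply: XO.
Qed.

Lemma w_le_shift k X : w_le w k X -> w_le w (k + 1) (shift X).
Proof.
move=> /w_leP XL; apply/w_leP; apply: LO_iso XL.
by have := shiftzD (- (k + 1)) 1 X; rewrite opprD addrNK.
Qed.

Lemma w_ge_shift k X : w_ge w k X -> w_ge w (k + 1) (shift X).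
Proof.
rewrite -{1}[k](subrK 1) => /w_geP XR; apply/w_geP; apply: RO_iso XR.
by have := shiftzD (- k) 1 X; rewrite opprB addrC.
Qed.

Lemma w_orth j k X Y : j < k -> w_le w j X -> w_ge w k Y -> orth X Y.
Proof.
move=> jk Xj Yk; apply: (w_leE _ _).1 Xj _ _.
by apply: w_ge_leq Yk; rewrite lezD1.
Qed.

Lemma w_le_ext k X Y Z (f : mor X Y) (g : mor Y Z) h :
  dist f g h -> w_le w k X -> w_le w k Z -> w_le w k Y.
Proof.
move=> T /w_leE XO /w_leE ZO; apply/w_leE => W Wk u.
by have [v <-] := dist_extend T (XO W Wk (u \oc f)); rewrite (ZO W Wk v) cmp0m.
Qed.

Lemma w_le_retract k X Y : retract X Y -> w_le w k Y -> w_le w k X.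
Proof.
move=> [i [p pi1]] /w_leE YO; apply/w_leE => Z Zk u.
by rewrite -[u]cmpm1 -pi1 cmpA (YO Z Zk (u \oc p)) cmp0m.
Qed.

(** Shift back, decompose by the torsion theory, and shift forward again. *)
Lemma weight_dec_exists k X : exists D : weight_dec w k X, True.
Proof.
have [L [R [LL RR [f [g [h T0]]]]]] := torsion_dec w (shiftz C (- k) X).
have [h' T] := shiftz_dist k T0.
have [b [b' [b'b bb']]] := shiftzNK k X.
have b_iso : is_iso b by exists b'.
have kL : w_le w k (shiftz C k L).
  by exists L => //; apply: isomorphic_refl.
have kR : w_ge w (k + 1) (shiftz C k R).
  by apply/w_geP; apply: RO_iso RR; apply/isomorphic_sym/shiftzK.
suff T' : dist (b \oc fmor (shiftz C k) f) (fmor (shiftz C k) g \oc b') h'.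
  by exists (WeightDec kL kR T').
apply: (dist_iso (is_iso_idm _) b_iso (is_iso_idm _) _ _ _ T).
- by rewrite cmpm1.
- by rewrite -cmpA b'b cmp1m cmpm1.
- by rewrite fmor1 cmp1m cmpm1.
Qed.

Lemma wle_lift k X (D : weight_dec w k X) L (u : mor L X) :
  w_le w k L -> exists v : mor L (wle D), wle_mor D \oc v = u.
Proof.
move=> Lk; apply: dist_lift (weight_dist D) _.
by apply: (w_orth _ Lk (wge_in D)); rewrite ltzD1.
Qed.

(** A morphism killed by [shift (wle_mor D)] comes from a morphism from [L] to
    [wge D], which is zero by orthogonality. *)
Lemma wle_shift_inj k X (D : weight_dec w k X) L (u : mor L (shift (wle D))) :
  w_le w k L -> fmor shift (wle_mor D) \oc u = 0 -> u = 0.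
Proof.
move=> Lk /(dist_lift_shift (weight_dist D))[v <-].
suff -> : v = 0 by rewrite cmpm0.
by apply: (w_orth _ Lk (wge_in D)); rewrite ltzD1.
Qed.

Lemma wle_inj j k X (D : weight_dec w k X) L (u : mor L (wle D)) : j < k ->
  w_le w j L -> wle_mor D \oc u = 0 -> u = 0.
Proof.
move=> jk Lj Du; apply: shift_faithful; rewrite shift0.
apply: (@wle_shift_inj k X D).
  by apply: w_le_leq (w_le_shift Lj); rewrite lezD1.
by rewrite -fmorM Du shift0.
Qed.

End Weights.

(** * Images and exactness *)

(** Since [i] is a kernel of a cokernel of [f], it vanishes exactly when that
    cokernel is invertible, that is when [f] vanishes. *)
Lemma is_image_zero (A : preadditive) (X Y V : A) (f : mor X Y) (i : mor V Y) :
  is_image f i -> is_zero V <-> f = 0.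
Proof.
move=> [Q [q [[qf qU] [qi iU]]]]; split=> [V0|f0].
  by have [v [<- _]] := iU _ f qf; rewrite ((V0 X).2 v) cmpm0.
have [|v [vq _]] := qU _ (idm Y); first by rewrite f0 cmpm0.
have i0 : i = 0 by rewrite -[i]cmp1m -vq -cmpA qi cmpm0.
have [u [_ uU]] := iU _ i qi.
by apply/is_zeroP; rewrite -[LHS]uU ?cmpm1 // -[RHS]uU // i0 cmp0m.
Qed.

Lemma exact_zero (A : preadditive) (X Y Z : A) (f : mor X Y) (g : mor Y Z) :
  exact f g -> is_zero X -> is_zero Z -> is_zero Y.
Proof.
move=> [V [i [fi [_ iU]]]] X0 Z0.
have /(is_image_zero fi) V0 : f = 0 by apply: (X0 Y).1.
have [|v [iv _]] := iU _ (idm Y); first exact: (Z0 Y).2.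
by apply/is_zeroP; rewrite -iv ((V0 Y).1 i) cmp0m.
Qed.

Lemma Ab_zeroP (V : zmodType) : is_zero (V : Ab) <-> forall x : V, x = 0.
Proof.
rewrite is_zeroP; split=> [V0 x|V0]; last by apply: abHomP => x; apply: V0.
exact: (congr1 (fun h : abHom V V => h x) V0).
Qed.

Lemma Ab_exact (U V W : zmodType) (f : abHom U V) (g : abHom V W) :
    (forall y, g y = 0 <-> exists x, f x = y) ->
  exact (f : @mor Ab U V) (g : @mor Ab V W).
Proof.
move=> fg; have [gk kU] := ab_kernelP g.
exists (ab_ker g : zmodType), (ab_ker_inc g); split; last exact: ab_kernelP.
exists (ab_coker f), (ab_coker_proj f); split; first exact: ab_cokernelP.
split=> [|Z u fu].
  by apply: abHomP => -[x gx]; apply/ab_piP/fg/eqP.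
apply: kU; apply: abHomP => z; apply/fg; apply/(ab_piP f).
exact: (congr1 (fun h : abHom Z (ab_coker f) => h z) fu).
Qed.

(** * Cohomological functors *)

Section Cohomological.
Variable C : triangulated.

Lemma cofunctor_retract (A : preadditive) (H : cofunctor C A) (X Y : C) :
  retract X Y -> is_zero (H Y) -> is_zero (H X).
Proof.
move=> [i [p pi1]]; apply: retract_zero.
by exists (comor H p), (comor H i); rewrite -comorM pi1 comor1.
Qed.

(** Exactness at the middle term suffices: the other two positions are
    rotations, and powers of the shift preserve triangles up to the third
    morphism. *)
Lemma cohomologicalP (A : abelian_cat) (H : cofunctor C A) :
    (forall (X Y Z : C) (f : mor X Y) (g : mor Y Z) (h : mor Z (shift X)),
       dist f g h -> exact (comor H g) (comor H f)) ->
  cohomological H.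
Proof.
move=> Hex X Y Z f g h T i.
have Hi (X' Y' Z' : C) (f' : mor X' Y') (g' : mor Y' Z') h' : dist f' g' h' ->
    exact (comor H (fmor (shiftz C i) g')) (comor H (fmor (shiftz C i) f')).
  by move=> /(shiftz_dist i)[h'' /Hex].
split; [exact: Hi T | | exact: Hi (dist_rotN T)].
exact: Hi ((dist_rot _ _ _).1 T).
Qed.

End Cohomological.

(** * The virtual truncation of a representable functor *)

Section Truncation.
Variables (C : triangulated) (w : weight_structure C) (n : int).
Variables (D : forall X : C, weight_dec w n X) (I : C).

(** The natural transformations from C(-, X) to C(-, I) on objects of weights at
    most n, written as morphisms from w_n X to I by the Yoneda lemma.
    Quantifying over [L] inside a predicate keeps [trunc X] a subgroup of
    [mor (wle (D X)) I]; the group of families indexed by all objects could be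
    too large for a [zmodType]. *)
Definition trunc_pred (X : C) : {pred mor (wle (D X)) I} := fun phi =>
  `[< forall L (l : mor L (wle (D X))),
        w_le w n L -> wle_mor (D X) \oc l = 0 -> phi \oc l = 0 >].
Arguments trunc_pred : clear implicits.

Fact trunc_closed X : zmod_closed (trunc_pred X).
Proof.
split=> [|phi psi]; first by apply/asboolP => L l _ _; apply: cmp0m.
move=> /asboolP phiP /asboolP psiP; apply/asboolP => L l Ln Dl.
by rewrite cmpBl phiP // psiP // subrr.
Qed.
HB.instance Definition _ X :=
  GRing.isZmodClosed.Build (mor (wle (D X)) I) (trunc_pred X) (trunc_closed X).

Definition trunc (X : C) : Type := {phi | trunc_pred X phi}.
HB.instance Definition _ X := SubChoice.on (trunc X).
HB.instance Definition _ X := [SubChoice_isSubZmodule of trunc X by <:].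

(** An element of [trunc X] has a well-defined value on a morphism from [L] to
    [X], computed on any lift to [wle (D X)]. *)
Lemma trunc_eq X (phi : trunc X) L (l l' : mor L (wle (D X))) : w_le w n L ->
  wle_mor (D X) \oc l = wle_mor (D X) \oc l' -> val phi \oc l = val phi \oc l'.
Proof.
move=> Ln ll'; apply/eqP; rewrite -subr_eq0 -cmpBr; apply/eqP.
by case: phi => /= phi /asboolP; apply; rewrite // cmpBr ll' subrr.
Qed.

Definition trunc_lift X Y (g : mor X Y) : mor (wle (D X)) (wle (D Y)) :=
  sval (cid (wle_lift (D Y) (g \oc wle_mor (D X)) (wle_in (D X)))).

Lemma trunc_liftE X Y (g : mor X Y) :
  wle_mor (D Y) \oc trunc_lift g = g \oc wle_mor (D X).
Proof. by rewrite /trunc_lift; case: cid. Qed.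

Fact trunc_mor_subproof X Y (g : mor X Y) (phi : trunc Y) :
  trunc_pred X (val phi \oc trunc_lift g).
Proof.
apply/asboolP => L l Ln Dl; rewrite -cmpA -[RHS](cmpm0 _ (val phi)).
by apply: trunc_eq => //; rewrite cmpA trunc_liftE -cmpA Dl !cmpm0.
Qed.

Definition trunc_mor_fun X Y (g : mor X Y) (phi : trunc Y) : trunc X :=
  exist _ (val phi \oc trunc_lift g) (trunc_mor_subproof g phi).

Fact trunc_mor_additive X Y (g : mor X Y) : zmod_morphism (trunc_mor_fun g).
Proof. by move=> phi psi; apply: val_inj; apply: cmpBl. Qed.

Definition trunc_mor X Y (g : mor X Y) : @mor Ab (trunc Y) (trunc X) :=
  ab_hom (trunc_mor_additive g).

(** The chosen lift [trunc_lift g] can be replaced by any other, which is what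
    makes [trunc_mor] functorial. *)
Lemma val_trunc_mor X Y (g : mor X Y) (phi : trunc Y)
    (c : mor (wle (D X)) (wle (D Y))) :
  wle_mor (D Y) \oc c = g \oc wle_mor (D X) ->
  val ((trunc_mor g : abHom _ _) phi : trunc X) = val phi \oc c.
Proof.
move=> cE; apply: trunc_eq; first exact: wle_in.
by rewrite trunc_liftE cE.
Qed.

Fact trunc_mor1 X : trunc_mor (idm X) = idm (trunc X : Ab).
Proof.
apply: abHomP => phi; apply: val_inj; rewrite (@val_trunc_mor _ _ _ _ (idm _)).
  by rewrite cmpm1.
by rewrite cmp1m cmpm1.
Qed.

Fact trunc_morM X Y Z (g : mor Y Z) (f : mor X Y) :
  trunc_mor (g \oc f) = trunc_mor f \oc trunc_mor g.
Proof.
apply: abHomP => phi; apply: val_inj.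
rewrite (@val_trunc_mor _ _ _ _ (trunc_lift g \oc trunc_lift f)) ?cmpA //.
by rewrite trunc_liftE -cmpA trunc_liftE cmpA.
Qed.

Definition truncation : cofunctor C Ab :=
  @Cofunctor C Ab (fun X => trunc X : Ab) trunc_mor trunc_mor1 trunc_morM.

(** Given psi in the truncation at Y that vanishes on X, an object E of weights
    at most n is built between w_n X and w_n Z, over Y.  The value of psi on
    E -> Y vanishes on w_n X, so it factors through some theta : w_n Z -> I.
    Every such theta works: if L has weights at most n, a morphism L -> w_n Z
    whose image in Z comes from Y lifts to E. *)
Lemma truncation_cohomological : cohomological truncation.
Proof.
apply: cohomologicalP => X Y Z f g h T.
apply: Ab_exact => psi; split; last first.
  move=> [theta <-]; apply: val_inj.
  have -> : (trunc_mor f : abHom _ _) ((trunc_mor g : abHom _ _) theta) =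
      (trunc_mor (g \oc f) : abHom _ _) theta by rewrite trunc_morM.
  rewrite (@val_trunc_mor _ _ _ _ 0) ?cmpm0 //.
  by rewrite (dist_comp0 T) cmp0m.
move=> fpsi.
(* The morphism h lifts to the truncations, as there are no nonzero
   morphisms from weights at most n to weights at least n + 2. *)
have [d dE] : exists d : mor (wle (D Z)) (shift (wle (D X))),
    fmor shift (wle_mor (D X)) \oc d = h \oc wle_mor (D Z).
  have [h' TX] := shift_dist (weight_dist (D X)).
  apply: (dist_lift TX).
  apply: (w_orth _ (wle_in (D Z)) (w_ge_shift (wge_in (D X)))).
  by rewrite -addrA ltrDl.
have [E [p [q TE]]] := dist_cocone d.
have [y [yp yq]] := dist_mor2 TE T dE.
have En : w_le w n E := w_le_ext TE (wle_in (D X)) (wle_in (D Z)).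
have [y' y'E] := wle_lift (D Y) y En.
have psiyp : val psi \oc y' \oc p = 0.
  rewrite -cmpA -(@val_trunc_mor _ _ f) ?fpsi //.
  by rewrite cmpA y'E.
have [theta thetaq] := dist_extend TE psiyp.
(* Both requirements on theta are instances of the next claim: with u = 0 it
   says that theta lies in [trunc Z], and with u the identity that it maps to
   psi. *)
have thetaE L (l : mor L (wle (D Z))) (u : mor L (wle (D Y))) : w_le w n L ->
    wle_mor (D Z) \oc l = g \oc (wle_mor (D Y) \oc u) ->
    theta \oc l = val psi \oc u.
  move=> Ln lu.
  have dl : d \oc l = 0.
    apply: (wle_shift_inj (D := D X) Ln).
    rewrite cmpA dE -cmpA lu cmpA.
    by rewrite (dist_comp0 ((dist_rot _ _ _).1 T)) cmp0m.
  have [l' l'E] := dist_lift ((dist_rot _ _ _).1 TE) dl.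
  (* [l'] lifts [l] to [E], but its image in [Y] agrees with that of [u] only up
     to a morphism coming from [X]; correct it by [p \oc x']. *)
  have [|x xE] := dist_lift (u := y \oc l' - wle_mor (D Y) \oc u) T.
    by rewrite cmpBr cmpA -yq -cmpA l'E lu subrr.
  have [x' x'E] := wle_lift (D X) x Ln.
  rewrite -l'E cmpA thetaq -[RHS]addr0 -(cmp0m _ x') -psiyp -!cmpA -cmpDr.
  apply: trunc_eq => //.
  by rewrite cmpDr !cmpA y'E yp -(cmpA f) x'E xE addrC subrK.
have thetaP : trunc_pred Z theta.
  by apply/asboolP => L l Ln Dl; rewrite (thetaE _ _ 0 Ln) ?cmpm0.
exists (exist _ theta thetaP); apply: val_inj.
rewrite (val_trunc_mor _ (trunc_liftE g)) /= -[RHS]cmpm1.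
by apply: thetaE; [apply: wle_in | rewrite cmpm1 trunc_liftE].
Qed.

(** The value of phi on an object of weights at most n is a morphism from that
    object to I: below weight m there are none.  In weights at least n + 1 the
    morphism w_n X -> X is zero, so the defining condition kills phi. *)
Lemma truncation_range m :
  m <= n -> w_ge w m I -> weight_range w m n truncation.
Proof.
move=> mn Im; split=> X Xw; apply/Ab_zeroP => phi; apply: val_inj.
  have Xn : w_le w n X by apply: w_le_leq Xw; rewrite lerBlDr ler_wpDr.
  have [s sE] := wle_lift (D X) (idm X) Xn.
  rewrite -[LHS]cmpm1 (@trunc_eq _ phi _ _ (s \oc wle_mor (D X))).
  - rewrite cmpA; suff -> : val phi \oc s = 0 by rewrite cmp0m.
    by apply: (w_orth _ Xw Im); rewrite ltrBlDr ltzD1.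
  - exact: wle_in.
  - by rewrite cmpA sE cmpm1 cmp1m.
rewrite -[LHS]cmpm1 -[RHS](cmpm0 _ (val phi)); apply: trunc_eq.
  exact: wle_in.
rewrite cmpm1 cmpm0; apply: (w_orth _ (wle_in (D X)) Xw).
by rewrite ltzD1.
Qed.

(** The value [V] is an image inside [mor (wle D1) I] for a decomposition [D1]
    which need not be the chosen one; mutual lifts between [wle D1] and
    [wle (D X)] carry its elements to [trunc X] and back. *)
Lemma truncation_virtual X V : is_zero (truncation X) ->
  virtual_trunc w n (representable I) X V -> is_zero V.
Proof.
move=> /Ab_zeroP G0 [D1 [E [c [i [[d [cE _ _]] imi]]]]].
apply/(is_image_zero imi); apply: abHomP => psi; rewrite -[LHS]/(psi \oc c).
(* [c], hence every [psi \oc c], satisfies the condition defining [trunc], since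
   C(L, w_(n+1) X) injects into C(L, X). *)
have c0 L (l : mor L (wle D1)) :
    w_le w n L -> wle_mor D1 \oc l = 0 -> c \oc l = 0.
  move=> Ln Dl; apply: (@wle_inj _ w n (n + 1) X E) => //.
    by rewrite ltzD1.
  by rewrite cmpA cE cmp1m Dl.
have [t tE] := wle_lift D1 (wle_mor (D X)) (wle_in (D X)).
have [s sE] := wle_lift (D X) (wle_mor D1) (wle_in D1).
have phiP : trunc_pred X (psi \oc c \oc t).
  apply/asboolP => L l Ln Dl; rewrite -!cmpA c0 ?cmpm0 //.
  by rewrite cmpA tE.
have /(congr1 val)/= phi0 := G0 (exist _ (psi \oc c \oc t) phiP).
have -> : psi \oc c = psi \oc c \oc t \oc s.
  apply/eqP; rewrite -subr_eq0 -!(cmpA psi) -cmpBr -[X in c - X]cmpA.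
  rewrite -{1}[c]cmpm1 -cmpBr c0 ?cmpm0 //; first exact: wle_in.
  by rewrite cmpBr cmpm1 cmpA tE sE subrr.
by rewrite phi0 cmp0m.
Qed.

End Truncation.

(** * Objects without weights *)

Section WithoutWeights.
Variables (C : triangulated) (w : weight_structure C) (m n : int).
Hypothesis hmn : m <= n.
Implicit Type M : C.

Lemma wle_mor_connecting k l M (D : weight_dec w k M) (E : weight_dec w l M)
    (c : mor (wle D) (wle E)) :
  wle_mor E \oc c = wle_mor D -> wle_connecting c.
Proof.
move=> cE; have [|d [dg dh]] := dist_mor (a := c) (b := idm M)
    (weight_dist D) (weight_dist E); first by rewrite cmp1m.
by exists d; split; rewrite ?cmp1m // dg cmpm1.
Qed.

(** [wle_mor D] is killed by [wge_mor E], so it lifts to [wle E]. *)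
Lemma without_weights_factor M : without_weights w m n M ->
  exists (D : weight_dec w n M) (E : weight_dec w (m - 1) M)
    (c : mor (wle D) (wle E)), wle_mor E \oc c = wle_mor D.
Proof.
move=> [D [E]]; rewrite cmpm1 => /(dist_lift (weight_dist E))[c cE].
by exists D, E, c.
Qed.

(** The triangle [D] is pushed out along [c] to an extension of [wge D] by
    [wle E].  The morphism [wle_mor E] extends to it because [wle_mor E \oc c]
    is [wle_mor D], whose shift kills [wbd D]. *)
Lemma without_weights_retract M : without_weights w m n M ->
  exists Mt A B : C,
    [/\ retract M Mt, w_le w (m - 1) A, w_ge w (n + 1) B
      & is_extension Mt B A].
Proof.
move=> /without_weights_factor[D [E [c cE]]].
have [Mt [a [b T]]] := dist_cocone (fmor shift c \oc wbd D).
exists Mt, (wle E), (wge D); split; [|exact: wle_in|exact: wge_in|]; last first.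
  by exists a, b, (fmor shift c \oc wbd D).
have [|i [iD iq]] := dist_mor2 (a := c) (c := idm _) (weight_dist D) T.
  by rewrite cmpm1.
have [|p pa] := dist_extend_shift (u := wle_mor E) T.
  by rewrite cmpA -fmorM cE (dist_comp0 (dist_rotN (weight_dist D))).
(* [p \oc i] agrees with the identity after composition with [wle_mor D]; the
   difference factors through [wge D] and is absorbed into [p]. *)
have [|e eE] := dist_extend (u := idm M - p \oc i) (weight_dist D).
  by rewrite cmpBl cmp1m -cmpA iD cmpA pa cE subrr.
exists i, (p + e \oc b).
by rewrite cmpDl -(cmpA e) -iq cmp1m eE addrC subrK.
Qed.

Lemma retract_extension_zero (A : abelian_cat) (H : cofunctor C A)
    M Mt (X Y : C) : cohomological H -> weight_range w m n H ->
  retract M Mt -> w_le w (m - 1) X -> w_ge w (n + 1) Y ->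
  is_extension Mt Y X -> is_zero (H M).
Proof.
move=> Hc [Hl Hg] MMt Xm Yn [f [g [h T]]].
apply: cofunctor_retract MMt _.
have [fg _ _] := Hc _ _ _ _ _ _ T 0.
exact: exact_zero fg (Hg Y Yn) (Hl X Xm).
Qed.

Lemma cohomological_zero_virtual_trunc M :
    (forall (A : abelian_cat) (H : cofunctor C A),
      cohomological H -> weight_range w m n H -> is_zero (H M)) ->
  forall I : C, w_ge w m I ->
  forall V : Ab, virtual_trunc w n (representable I) M V -> is_zero V.
Proof.
move=> H0 I Im V.
pose D X := sval (cid (weight_dec_exists w n X)).
apply: (@truncation_virtual _ _ _ D); apply: H0.
  exact: truncation_cohomological.
exact: truncation_range.
Qed.

(** The morphism [wge_mor D0 \oc wle_mor D] whose vanishing is wanted factors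
    through the truncation in weight n + 1, so it lies in the image that is the
    virtual truncation. *)
Lemma trunc_zero_without_weights M (D0 : weight_dec w (m - 1) M) :
    (forall V : Ab,
      virtual_trunc w n (representable (wge D0)) M V -> is_zero V) ->
  without_weights w m n M.
Proof.
move=> H0; have [D _] := weight_dec_exists w n M.
have [E _] := weight_dec_exists w (n + 1) M.
have [|c cE] := wle_lift E (wle_mor D).
  by apply: w_le_leq (wle_in D); rewrite lerDl.
have [Q [q qc]] := Ab_has_cokernel (comor (representable (wge D0)) c).
have [V [i iq]] := Ab_has_kernel q.
have im : is_image (comor (representable (wge D0)) c) i by exists Q, q.
have V0 : is_zero V.
  by apply: H0; exists D, E, c, i; split=> //; apply: wle_mor_connecting.
exists D, D0; rewrite cmpm1 -cE cmpA.
have c0 := (is_image_zero im).1 V0.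
exact: (congr1 (fun h : abHom _ _ => h (wge_mor D0 \oc wle_mor E)) c0).
Qed.

(** The truncations [wle E] and [wle D] have a common retract [A], the image of
    the idempotent [c' \oc c], and [wle_mor D] factors through it. *)
Lemma without_weights_extension M : idempotent_complete C ->
  without_weights w m n M ->
  exists A B : C,
    [/\ w_le w (m - 1) A, w_ge w (n + 1) B & is_extension M B A].
Proof.
move=> idem /without_weights_factor[D [E [c' c'E]]].
have mn : m - 1 < n by rewrite ltrBlDr ltzD1.
have [|c cE] := wle_lift D (wle_mor E).
  by apply: w_le_leq (wle_in E); rewrite lerBlDr ler_wpDr.
have cc'c : c \oc c' \oc c = c.
  apply/eqP; rewrite -subr_eq0; apply/eqP.
  apply: (wle_inj (D := D) mn (wle_in E)).
  by rewrite cmpBr -!cmpA (cmpA _ c) cE cmpA c'E cE subrr.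
have [|A [i [p [pi1 ip]]]] := idem _ (c' \oc c).
  by rewrite -cmpA [X in _ \oc X]cmpA cc'c.
have pc'ci : p \oc c' \oc (c \oc i) = idm A.
  by rewrite -cmpA (cmpA c') -ip -(cmpA i) pi1 cmpm1.
have AD : wle_mor D \oc (c \oc i) = wle_mor E \oc i by rewrite cmpA cE.
have DA : wle_mor E \oc i \oc (p \oc c') = wle_mor D.
  by rewrite -cmpA (cmpA i) ip -!cmpA cmpA c'E !cmpA cE c'E.
have [B [b [h T]]] := dist_cone (wle_mor E \oc i).
exists A, B; split; last by exists (wle_mor E \oc i), b, h.
  by apply: w_le_retract (wle_in E); exists i, p.
(* For [L] of weights at most n, morphisms to [shift A] are detected in
   [shift M], since [A] is a retract of [wle D]; so [u] comes from [M], and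
   morphisms from [L] to [M] factor through [A]. *)
apply/w_geE => L Ln u.
have hu : h \oc u = 0.
  rewrite -[LHS]cmp1m -fmor1 -pc'ci fmorM -cmpA.
  suff -> : fmor shift (c \oc i) \oc (h \oc u) = 0 by rewrite cmpm0.
  apply: (wle_shift_inj (D := D) Ln).
  by rewrite !cmpA -fmorM AD (dist_comp0 (dist_rotN T)) cmp0m.
have [v <-] := dist_lift ((dist_rot _ _ _).1 T) hu.
have [v' <-] := wle_lift D v Ln.
by rewrite -DA -(cmpA (_ \oc i)) (cmpA b) (dist_comp0 T) cmp0m.
Qed.

(** As m <= n, the same triangle is a weight decomposition for both weights. *)
Lemma extension_isomorphic_wle M (A B : C) :
  w_le w (m - 1) A -> w_ge w (n + 1) B -> is_extension M B A ->
  exists (D : weight_dec w (m - 1) M) (E : weight_dec w n M),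
    isomorphic (wle D) (wle E).
Proof.
move=> Am Bn [f [g [h T]]].
have An : w_le w n A by apply: w_le_leq Am; rewrite lerBlDr ler_wpDr.
have Bm : w_ge w (m - 1 + 1) B.
  by apply: w_ge_leq Bn; rewrite subrK ler_wpDr.
by exists (WeightDec Am Bm T), (WeightDec An Bn T); apply: isomorphic_refl.
Qed.

(** The n-weight decomposition [E] is also an (m - 1)-weight decomposition, as
    its first term is isomorphic to [wle D]; the connecting morphism between the
    two readings of [E] is the identity. *)
Lemma isomorphic_wle_connecting M :
  (exists (D : weight_dec w (m - 1) M) (E : weight_dec w n M),
    isomorphic (wle D) (wle E)) ->
  exists (D : weight_dec w (m - 1) M) (E : weight_dec w n M)
    (c : mor (wle D) (wle E)), wle_connecting c /\ is_iso c.
Proof.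
move=> [D [E DE]].
have Em : w_le w (m - 1) (wle E) := w_le_iso DE (wle_in D).
have Bm : w_ge w (m - 1 + 1) (wge E).
  by apply: w_ge_leq (wge_in E); rewrite subrK ler_wpDr.
exists (WeightDec Em Bm (weight_dist E)), E, (idm _); split.
  by apply: wle_mor_connecting; apply: cmpm1.
exact: is_iso_idm.
Qed.

Lemma iso_connecting_without_weights M (D : weight_dec w (m - 1) M)
    (E : weight_dec w n M) (c : mor (wle D) (wle E)) :
  wle_connecting c -> is_iso c -> without_weights w m n M.
Proof.
move=> [d [cE _ _]] [c' [_ cc']]; exists E, D.
rewrite cmpm1 -[wle_mor E]cmpm1 -cc' (cmpA (wle_mor E)) cE cmp1m cmpA.
by rewrite (dist_comp0 (weight_dist D)) cmp0m.
Qed.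

End WithoutWeights.

Theorem theorem2p2p2 (C : triangulated) (w : weight_structure C) (m n : int)
    (hmn : m <= n) (M : C) (D0 : weight_dec w (m - 1) M) :
  [<->
    (* I.1 *)
    without_weights w m n M;
    (* I.2 *)
    exists Mt A B : C,
      [/\ retract M Mt, w_le w (m - 1) A, w_ge w (n + 1) B
        & is_extension Mt B A];
    (* I.3 *)
    forall (A : abelian_cat) (H : cofunctor C A),
      cohomological H -> weight_range w m n H -> is_zero (H M);
    (* I.4 *)
    forall I : C, w_ge w m I ->
      forall V : Ab, virtual_trunc w n (representable I) M V -> is_zero V;
    (* I.5, with I_0 = wge D0 *)
    forall V : Ab, virtual_trunc w n (representable (wge D0)) M V -> is_zero V
  ]
  /\
  (idempotent_complete C ->
   [<->
    (* I.1 *)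
    without_weights w m n M;
    (* II.1 *)
    exists A B : C,
      [/\ w_le w (m - 1) A, w_ge w (n + 1) B & is_extension M B A];
    (* II.2 *)
    exists (D : weight_dec w (m - 1) M) (E : weight_dec w n M),
      isomorphic (wle D) (wle E);
    (* II.3 *)
    exists (D : weight_dec w (m - 1) M) (E : weight_dec w n M)
      (c : mor (wle D) (wle E)),
      wle_connecting c /\ is_iso c
   ]).
Proof.
split=> [|idem]; tfae.
- exact: without_weights_retract.
- move=> [Mt [A [B [MMt Am Bn E]]]] A' H Hc Hr.
  exact: retract_extension_zero Hc Hr MMt Am Bn E.
- exact: cohomological_zero_virtual_trunc.
- by move=> H0; apply: H0; rewrite -[m in w_ge w m](subrK 1); apply: wge_in.
- exact: trunc_zero_without_weights.
- exact: without_weights_extension.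
- by move=> [A [B [Am Bn E]]]; apply: extension_isomorphic_wle Am Bn E.
- exact: isomorphic_wle_connecting.
- by move=> [D [E [c [cE c_iso]]]]; apply: iso_connecting_without_weights c_iso.
Qed.
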